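(* Let $X=(X_1,X_2)^\top\sim\mathcal N_2(\boldsymbol\mu,\boldsymbol\Sigma)$ be a bivariate normal random vector with mean $\boldsymbol\mu=(\mu_1,\mu_2)^\top\in\mathbb R^2$ and covariance matrix $\boldsymbol\Sigma$ having diagonal elements $\sigma_1^2,\sigma_2^2$ and off-diagonal element $\rho\sigma_1\sigma_2$, where $\sigma_1,\sigma_2>0$ and $|\rho|<1$. Let $\alpha,\beta,\eta,\psi,\delta$ be the constants determined by $(\mu_1,\mu_2,\sigma_1,\sigma_2,\rho)$ as in the context. Then $R=\sqrt{X_1^2+X_2^2}$ has probability density function $$f_R(r;\boldsymbol\mu,\boldsymbol\Sigma)=\alpha\, r\exp(-\beta r^2)\Big\{\sum_{j=0}^\infty \epsilon_j\, I_{2j}(\psi r)\,I_j(\eta r^2)\cos(2j\delta)\Big\}\mathbf 1[r>0].$$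
   Context: $\mathbf 1[\cdot]$ is the indicator function, $\epsilon_0=1$ and $\epsilon_j=2$ for $j\ge1$, and $I_m$ is the modified Bessel function of the first kind of order $m$. The constants are $$\alpha=\frac{1}{\sigma_1\sigma_2\sqrt{1-\rho^2}}\exp\left(-\frac{\mu_1^2\sigma_2^2+\sigma_1^2\mu_2^2-2\rho\sigma_1\sigma_2\mu_1\mu_2}{2\sigma_1^2\sigma_2^2(1-\rho^2)}\right),\qquad \beta=\frac{\sigma_1^2+\sigma_2^2}{4\sigma_1^2\sigma_2^2(1-\rho^2)},$$ $$\eta=\frac{\sqrt{(\sigma_2^2-\sigma_1^2)^2+4\sigma_1^2\sigma_2^2\rho^2}}{4\sigma_1^2\sigma_2^2(1-\rho^2)},\qquad \psi=\frac{\sqrt{\sigma_1^2(\rho\mu_1\sigma_2-\mu_2\sigma_1)^2+\sigma_2^2(\rho\mu_2\sigma_1-\mu_1\sigma_2)^2}}{\sigma_1^2\sigma_2^2(1-\rho^2)},$$ and $\delta=\tilde\phi-\phi/2$, where the angles $\tilde\phi,\phi$ satisfy $$\cos\tilde\phi=\frac{\mu_2\sigma_1^2-\rho\mu_1\sigma_1\sigma_2}{D},\quad \sin\tilde\phi=\frac{\mu_1\sigma_2^2-\rho\mu_2\sigma_1\sigma_2}{D},\quad D=\sqrt{\mu_1^2\sigma_2^4+\mu_2^2\sigma_1^4+\rho^2\sigma_1^2\sigma_2^2(\mu_1^2+\mu_2^2)-2\rho\mu_1\mu_2\sigma_1\sigma_2(\sigma_1^2+\sigma_2^2)},$$ $$\cos\phi=\frac{\sigma_2^2-\sigma_1^2}{\sqrt{(\sigma_1^2-\sigma_2^2)^2+4\rho^2\sigma_1^2\sigma_2^2}},\quad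 \sin\phi=\frac{2\rho\sigma_1\sigma_2}{\sqrt{(\sigma_1^2-\sigma_2^2)^2+4\rho^2\sigma_1^2\sigma_2^2}}.$$ If the denominator in the definition of $\tilde\phi$ (i.e. $\psi=0$) or of $\phi$ (i.e. $\eta=0$) vanishes, the corresponding angle is arbitrary. *)

(* Defs.v *)
From HB Require Import structures.
From mathcomp Require Import all_boot all_order all_algebra.
From mathcomp Require Import all_classical all_reals all_analysis.
From mathcomp Require Import measurable_realfun.

Set Implicit Arguments.
Unset Strict Implicit.
Unset Printing Implicit Defensive.

Import Order.TTheory GRing.Theory Num.Theory.
Import numFieldNormedType.Exports.

Local Open Scope classical_set_scope.
Local Open Scope ring_scope.

Section BesselI.
Variable R : realType.
Implicit Type x : R.

Definition besselI_coeff (m : nat) x (k : nat) : R :=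
  (x / 2) ^+ (2 * k + m) / (k`! * (k + m)`!)%:R.

(* Modified Bessel function of the first kind, of integer order m >= 0. *)
Definition besselI (m : nat) x : R := limn (series (besselI_coeff m x)).

(* The defining series converges everywhere, so that the limit above is never
   the default value of [limn]. *)
Lemma is_cvg_series_besselI_coeff m x : cvgn (series (besselI_coeff m x)).
Proof.
pose y := `|x / 2|.
have y_ge0 n : 0 <= y ^+ n by rewrite exprn_ge0 ?normr_ge0.
apply: normed_cvg.
apply: (@series_le_cvg _ _ (y ^+ m *: exp_coeff (y ^+ 2))) => [k|k|k|].
- exact: normr_ge0.
- exact: mulr_ge0 (y_ge0 m) (exp_coeff_ge0 k (y_ge0 2)).
- rewrite /besselI_coeff /= normrM normrX -/y normfV normr_nat exprD exprM.
  rewrite /exp_coeff /= [X in X * _]mulrC -mulrA ler_wpM2l// ler_wpM2l//; first by rewrite exprn_ge0.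
  rewrite lef_pV2 ?posrE ?ltr0n ?muln_gt0 ?fact_gt0//.
  by rewrite ler_nat leq_pmulr ?fact_gt0.
- exact/is_cvg_seriesZ/is_cvg_series_exp_coeff.
Qed.

End BesselI.

Section Probability.
Context d (T : measurableType d) (R : realType) (P : probability T R).

Definition has_pdf (Y : {RV P >-> R}) (f : R -> R) : Prop :=
  [/\ measurable_fun [set: R] f,
      forall r, 0 <= f r &
      forall A : set R, measurable A ->
        distribution P Y A = (\int[lebesgue_measure]_(r in A) (f r)%:E)%E].

Definition cvec2 (a b : R) : 'cV[R]_2 := \col_i (if i == 0 then a else b).

Definition normal2_pdf (mu : 'cV[R]_2) (Sigma : 'M[R]_2) (x : R * R) : R :=
  let y := cvec2 x.1 x.2 - mu in
  (Num.sqrt (\det ((2 * pi) *: Sigma)))^-1 *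
  expR (- (y^T *m invmx Sigma *m y) 0 0 / 2).

(* N_2(mu, Sigma), for a positive definite covariance matrix Sigma. *)
Definition bivariate_normal (X : {RV P >-> (R * R)%type})
    (mu : 'cV[R]_2) (Sigma : 'M[R]_2) : Prop :=
  forall A : set (R * R), measurable A ->
    distribution P X A =
    (\int[lebesgue_measure \x lebesgue_measure]_(x in A)
       (normal2_pdf mu Sigma x)%:E)%E.

Definition enorm2 (X : T -> R * R) (t : T) : R :=
  Num.sqrt ((X t).1 ^+ 2 + (X t).2 ^+ 2).

Section enorm2_measurable.
Variable X : {RV P >-> (R * R)%type}.

Lemma measurable_enorm2 : measurable_fun [set: T] (enorm2 X).
Proof.
have mX : measurable_fun [set: T] X by [].
pose g (t : T) := (X t).1 ^+ 2 + (X t).2 ^+ 2.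
have mg : measurable_fun [set: T] g.
  apply: measurable_funD; apply: measurable_funX.
  - exact: (measurableT_comp measurable_fst).
  - exact: (measurableT_comp measurable_snd).
have ms : measurable_fun [set: R] (@Num.sqrt R).
  exact: (continuous_measurable_fun (@sqrt_continuous R)).
exact: (measurableT_comp ms mg).
Qed.

HB.instance Definition _ :=
  isMeasurableFun.Build _ _ T R (enorm2 X) measurable_enorm2.

End enorm2_measurable.
End Probability.

Section Constants.
Variables (R : realType) (mu1 mu2 s1 s2 rho : R).

Definition cov2 : 'M[R]_2 :=
  \matrix_(i, j) (if i == j then (if i == 0 then s1 ^+ 2 else s2 ^+ 2)
                  else rho * s1 * s2).

Definition alpha : R :=
  (s1 * s2 * Num.sqrt (1 - rho ^+ 2))^-1 *
  expR (- ((mu1 ^+ 2 * s2 ^+ 2 + s1 ^+ 2 * mu2 ^+ 2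
            - 2 * rho * s1 * s2 * mu1 * mu2)
           / (2 * s1 ^+ 2 * s2 ^+ 2 * (1 - rho ^+ 2)))).

Definition beta : R :=
  (s1 ^+ 2 + s2 ^+ 2) / (4 * s1 ^+ 2 * s2 ^+ 2 * (1 - rho ^+ 2)).

Definition eta : R :=
  Num.sqrt ((s2 ^+ 2 - s1 ^+ 2) ^+ 2 + 4 * s1 ^+ 2 * s2 ^+ 2 * rho ^+ 2)
  / (4 * s1 ^+ 2 * s2 ^+ 2 * (1 - rho ^+ 2)).

Definition psi : R :=
  Num.sqrt (s1 ^+ 2 * (rho * mu1 * s2 - mu2 * s1) ^+ 2
            + s2 ^+ 2 * (rho * mu2 * s1 - mu1 * s2) ^+ 2)
  / (s1 ^+ 2 * s2 ^+ 2 * (1 - rho ^+ 2)).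

Definition phit_den : R :=
  Num.sqrt (mu1 ^+ 2 * s2 ^+ 4 + mu2 ^+ 2 * s1 ^+ 4
            + rho ^+ 2 * s1 ^+ 2 * s2 ^+ 2 * (mu1 ^+ 2 + mu2 ^+ 2)
            - 2 * rho * mu1 * mu2 * s1 * s2 * (s1 ^+ 2 + s2 ^+ 2)).

Definition phi_den : R :=
  Num.sqrt ((s1 ^+ 2 - s2 ^+ 2) ^+ 2 + 4 * rho ^+ 2 * s1 ^+ 2 * s2 ^+ 2).

(* The angles are only constrained when the denominators do not vanish; they
   are arbitrary reals otherwise. *)
Definition is_phit (phit : R) : Prop :=
  phit_den != 0 ->
  cos phit = (mu2 * s1 ^+ 2 - rho * mu1 * s1 * s2) / phit_den /\
  sin phit = (mu1 * s2 ^+ 2 - rho * mu2 * s1 * s2) / phit_den.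

Definition is_phi (phi : R) : Prop :=
  phi_den != 0 ->
  cos phi = (s2 ^+ 2 - s1 ^+ 2) / phi_den /\
  sin phi = (2 * rho * s1 * s2) / phi_den.

End Constants.

Definition eps_coef (R : realType) (j : nat) : R := if j == 0%N then 1 else 2.

Definition norm_term (R : realType) (psi eta delta r : R) (j : nat) : R :=
  eps_coef R j * besselI (2 * j) (psi * r) * besselI j (eta * r ^+ 2)
  * cos ((2 * j)%:R * delta).

(* Main.v *)
Require Import Defs.
From mathcomp Require Import all_boot all_order all_algebra.
From mathcomp Require Import all_classical all_reals all_analysis.
From mathcomp Require Import measurable_realfun.
From mathcomp Require Import ring lra zify.
Import Order.TTheory GRing.Theory Num.Theory.
Import numFieldNormedType.Exports.
Set Implicit Arguments.
Unset Strict Implicit.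
Unset Printing Implicit Defensive.

Local Open Scope classical_set_scope.
Local Open Scope ring_scope.

(** In polar coordinates the exponent of the Gaussian density at
    [(r cos t, r sin t)] is a constant plus
      [- beta r^2 + psi r cos v + eta r^2 cos (2 (v - delta))],
    where [v] is [t] shifted by [phit - pi / 2] and [delta = phit - phi / 2]
    ([normal2_pdf_polar]): the linear part of the quadratic form is a single
    harmonic of frequency one, and its quadratic part is a constant plus a single
    harmonic of frequency two.  The density of the norm at [r > 0] is therefore
    [alpha r expR (- beta r^2)] times the mean over a full turn of
    [expR (psi r cos v) * expR (eta r^2 cos (2 (v - delta)))].  Pairing each point
    with its antipode turns the first factor into a hyperbolic cosine, of period
    [pi], so that half a turn is enough.

    This mean is evaluated with the Jacobi-Anger expansion
      [expR (x cos s) = \sum_j eps_j I_j(x) cos (j s)]   ([jacobi_anger]).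
    The hyperbolic cosine keeps the even orders [2 j] only, and the expansion of
    [expR (eta r^2 cos (2 (v - delta)))] has the same frequencies.  By orthogonality
    of the cosines only the products of equal frequencies survive, each
    contributing [eps_j I_(2j)(psi r) I_j(eta r^2) cos (2 j delta)]
    ([bessel_product_integral]).

    The Jacobi-Anger expansion comes from one summable family over pairs [(k, l)],
    with coefficients [(x/2)^(k+l) / (k! l!)], summed in two ways: along [k + l] it
    gives the exponential series, through the binomial expansion of
    [(2 cos s)^n], and along [|k - l|] it gives the Bessel functions.

    The polar change of variables ([polar_norm]) is reduced to
    one-dimensional facts: write [y = x m] on each vertical line, exchange the
    integrals, rescale [x] by [cos (atan m)] on each line through the origin, exchange
    again, and put [m = tan t].  The set to be measured only depends on the radius, so
    the last substitution is applied to a continuous integrand. *)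

(** * The Jacobi-Anger expansion *)

Lemma sum_bin_recr (R : pzRingType) (n : nat) (f : nat -> R) :
  \sum_(k < n.+2) 'C(n.+1, k)%:R * f k =
  \sum_(k < n.+1) 'C(n, k)%:R * (f k + f k.+1).
Proof.
rewrite big_ord_recl /= bin0 mul1r.
under eq_bigr do rewrite /bump /= add1n binS natrD mulrDl.
rewrite big_split /= big_ord_recr /= bin_small// mul0r addr0.
under [RHS]eq_bigr do rewrite mulrDr.
rewrite big_split /= addrA; congr (_ + _).
by rewrite [RHS]big_ord_recl /= bin0 mul1r.
Qed.

(** The real part of [(e^(it) + e^(-it))^n e^(i tau)]; the phase [tau] makes the
    induction on [n] go through, by the product-to-sum formula. *)
Lemma sum_bin_cos (R : realType) (n : nat) (t tau : R) :
  \sum_(k < n.+1) 'C(n, k)%:R * cos (tau + (n%:R - k%:R * 2) * t) =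
  (2 * cos t) ^+ n * cos tau.
Proof.
elim: n tau => [|n IH] tau.
  by rewrite big_ord_recl big_ord0 /= bin0 expr0 !mul1r mul0r subrr mul0r !addr0.
rewrite (@sum_bin_recr _ n (fun k => cos (tau + (n.+1%:R - k%:R * 2) * t))).
transitivity (\sum_(k < n.+1)
   ('C(n, k)%:R * cos (tau + t + (n%:R - k%:R * 2) * t)
    + 'C(n, k)%:R * cos (tau - t + (n%:R - k%:R * 2) * t))).
  apply: eq_bigr => k _; rewrite -mulrDr -!natr1.
  by congr (_ * (cos _ + cos _)); ring.
rewrite big_split /= !IH -mulrDr exprSr -mulrA; congr (_ * _).
by rewrite cosB cosD; ring.
Qed.

(** Families with values in [[0, +oo]] can be rearranged freely; this brings the
    result back to real series. *)
Lemma nneseries_EFinP (R : realType) (u : R ^nat) (l : R) :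
  (forall n, 0 <= u n) ->
  ((\sum_(0 <= n <oo) (u n)%:E = l%:E)%E <-> series u @ \oo --> l).
Proof.
move=> u0.
have E : (fun n => \sum_(0 <= i < n) (u i)%:E)%E = EFin \o series u.
  by apply/funext => n; rewrite /= /series /= sumEFin.
split=> [H|H].
  suff : EFin \o series u @ \oo --> l%:E by move/fine_cvgP => [].
  rewrite -E; apply: cvg_toP H.
  by apply: is_cvg_nneseries => n _ _; rewrite lee_fin.
by apply/cvg_lim => //; rewrite E; apply/cvg_EFin => //; apply: nearW.
Qed.

Section jacobi_anger.
Variable R : realType.
Implicit Types (x b t : R) (w : nat -> R).

(** The general term of the double series [expR x * expR x]. *)
Let c x (k l : nat) : R := x ^+ k / k`!%:R * (x ^+ l / l`!%:R).

Let c_ge0 x k l : 0 <= x -> 0 <= c x k l.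
Proof. by move=> x0; rewrite /c !mulr_ge0 ?invr_ge0 ?exprn_ge0. Qed.

Let c_bin x k l : c x k l = x ^+ (k + l) / (k + l)`!%:R * 'C(k + l, k)%:R.
Proof.
rewrite -(bin_fact (leq_addr l k)) addKn !natrM /c exprD.
by field; rewrite !pnatr_eq0 -!lt0n !fact_gt0 bin_gt0 leq_addr.
Qed.

Lemma besselI_ge0 m b : 0 <= b -> 0 <= besselI m b.
Proof.
move=> b0; apply: limr_ge; first exact: is_cvg_series_besselI_coeff.
apply: nearW => n; apply: sumr_ge0 => k _.
by rewrite /besselI_coeff mulr_ge0 ?invr_ge0 ?exprn_ge0 ?divr_ge0.
Qed.

Let besselI_double m b : 0 <= b ->
  (\sum_(0 <= k <oo) (c (b / 2) (k + m) k)%:E = (besselI m b)%:E)%E.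
Proof.
move=> b0; apply/nneseries_EFinP => [k|]; first by apply: c_ge0; rewrite divr_ge0.
rewrite (_ : (fun k => _) = besselI_coeff m b).
  exact: is_cvg_series_besselI_coeff.
apply/funext => k; rewrite /c /besselI_coeff natrM invfM mul2n -addnn !exprD.
by move: (_^-1) (_^-1) => u v; ring.
Qed.

(** The pairs with [|k - l| = j] form one diagonal for [j = 0] and two symmetric ones
    for [j > 0], whence [eps_coef]; along each of them the coefficients sum to
    [besselI j b]. *)
Let esum_by_difference b w : 0 <= b -> (forall j, 0 <= w j) ->
  (\esum_(p in [set: nat * nat]) (c (b / 2) p.1 p.2 * w `|p.1 - p.2|%N)%:E =
   \sum_(0 <= j <oo) (eps_coef R j * besselI j b * w j)%:E)%E.
Proof.
move=> b0 w0.
pose g (p : nat * nat) := (c (b / 2) p.1 p.2 * w `|p.1 - p.2|%N)%:E.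
have g0 (p : nat * nat) : (0 <= g p)%E.
  by rewrite lee_fin mulr_ge0 ?c_ge0 ?divr_ge0.
rewrite -[LHS]/(\esum_(p in [set: nat * nat]) g p)%E.
rewrite (esumID [set p : nat * nat | (p.2 <= p.1)%N])// !setTI.
(* [e] runs through the pairs on or below the diagonal, [e'] through those above
   it; the first index is the diagonal ([j], respectively [j - 1]). *)
pose e (p : nat * nat) := (p.2 + p.1, p.2)%N.
pose e' (p : nat * nat) := (p.2, p.2 + p.1.+1)%N.
have be : set_bij [set: nat * nat] [set p | (p.2 <= p.1)%N] e.
  split => //=.
  - by move=> [i j] _ /=; exact: leq_addr.
  - move=> [i j] [k l] _ _ /= [ji jl]; congr (_, _); lia.
  - move=> [i j] /= ij; exists (i - j, j)%N => //; rewrite /e /=; congr (_, _); lia.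
have be' : set_bij [set: nat * nat] (~` [set p | (p.2 <= p.1)%N]) e'.
  split => //=.
  - by move=> [i j] _ /=; rewrite /e'/=; lia.
  - move=> [i j] [k l] _ _ /= [jl ji]; congr (_, _); lia.
  - move=> [i j] /= ij; exists (j - i.+1, i)%N => //; rewrite /e' /=; congr (_, _); lia.
rewrite (reindex_esum _ _ _ _ be) (reindex_esum _ _ _ _ be').
have H (h : nat * nat -> \bar R) : (forall p, 0 <= h p)%E ->
    (\esum_(p in [set: nat * nat]) h p =
     \sum_(0 <= j <oo) \sum_(0 <= k <oo) h (j, k))%E.
  move=> h0; rewrite nneseries_esumT; last by move=> n; apply: nneseries_ge0.
  rewrite (eq_esum (b := fun j => \esum_(k in [set: nat]) h (j, k))%E).
    rewrite esum_esum//= (_ : _ `*`` _ = [set: nat * nat]); last exact/seteqP.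
    by apply: eq_esum => -[].
  by move=> j _; rewrite nneseries_esumT.
rewrite !H//.
pose a j := besselI j b * w j.
have a0 j : (0 <= (a j)%:E)%E by rewrite lee_fin mulr_ge0 ?besselI_ge0.
have S1 j : (\sum_(0 <= k <oo) g (e (j, k)) = (a j)%:E)%E.
  rewrite /a mulrC EFinM -besselI_double// -nneseriesZl ?lee_fin//; last first.
    by move=> *; rewrite lee_fin c_ge0 ?divr_ge0.
  apply: eq_eseriesr => k _; rewrite /g /= mulrC EFinM; congr (_%:E * _)%E; congr w; lia.
have S2 j : (\sum_(0 <= k <oo) g (e' (j, k)) = (a j.+1)%:E)%E.
  rewrite /a mulrC EFinM -besselI_double// -nneseriesZl ?lee_fin//; last first.
    by move=> *; rewrite lee_fin c_ge0 ?divr_ge0.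
  apply: eq_eseriesr => k _; rewrite /g /= mulrC EFinM; congr (_%:E * _)%E.
    congr w; lia.
  by rewrite /c mulrC.
under eq_eseriesr do rewrite S1.
under [X in (_ + X)%E]eq_eseriesr do rewrite S2.
have E0 k : (0 <= (eps_coef R k * besselI k b * w k)%:E)%E.
  by rewrite lee_fin -mulrA mulr_ge0// ?mulr_ge0 ?besselI_ge0// /eps_coef; case: ifP.
rewrite nneseries_recl// [RHS]nneseries_recl// -addeA; congr (_ + _)%E.
  by rewrite /eps_coef eqxx mul1r.
rewrite -(nneseries_addn 1 a0) -(nneseries_addn 1 E0) -nneseriesD//.
apply: eq_eseriesr => k _; rewrite addn1 -EFinD; congr EFin.
by rewrite /eps_coef /= -mulrA mulrDl mul1r.
Qed.

(** Along an antidiagonal [k + l = n] the coefficients are binomial coefficients,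
    up to the factor [(b / 2)^n / n!]. *)
Let esum_by_total b w : 0 <= b -> (forall j, 0 <= w j) ->
  (\esum_(p in [set: nat * nat]) (c (b / 2) p.1 p.2 * w `|p.1 - p.2|%N)%:E =
   \sum_(0 <= n <oo)
     ((b / 2) ^+ n / n`!%:R * \sum_(k < n.+1) 'C(n, k)%:R * w `|k - (n - k)%N|%N)%:E)%E.
Proof.
move=> b0 w0.
pose g (p : nat * nat) := (c (b / 2) p.1 p.2 * w `|p.1 - p.2|%N)%:E.
have g0 (p : nat * nat) : (0 <= g p)%E.
  by rewrite lee_fin mulr_ge0 ?c_ge0 ?divr_ge0.
rewrite -[LHS]/(\esum_(p in [set: nat * nat]) g p)%E.
pose F n := [set p : nat * nat | p.1 + p.2 = n]%N.
rewrite (_ : [set: nat * nat] = \bigcup_n F n); last first.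
  by apply/seteqP; split => // p _; exists (p.1 + p.2)%N.
rewrite nneseries_sum_bigcup//; last first.
  by move=> i j _ _ [p [<- <-]].
apply: eq_eseriesr => n _.
have bn : set_bij [set` 'I_n.+1] (F n) (fun k : 'I_n.+1 => (nat_of_ord k, n - k)%N).
  split => //=.
  - by move=> k _ /=; rewrite /F/= subnKC// -ltnS.
  - by move=> i j _ _ [/val_inj].
  - move=> [i j] /= <-; have il : (i < (i + j).+1)%N by lia.
    by exists (Ordinal il) => //=; rewrite addKn.
rewrite (reindex_esum _ _ _ _ bn) esum_fset// fsbig_finite//=.
rewrite (perm_big (index_enum 'I_n.+1)) /=; last first.
  apply: uniq_perm; [exact: finmap.fset_uniq|exact: index_enum_uniq|move=> i].
  by rewrite in_fset_set// mem_index_enum; apply/mem_set.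
rewrite sumEFin; congr EFin; rewrite mulr_sumr; apply: eq_bigr => k _.
rewrite mulrA; congr (_ * _) => /=.
have kn : (k <= n)%N by rewrite -ltnS.
by rewrite c_bin subnKC.
Qed.

(** The weights [1 + cos (j s)] are nonnegative, so the two summations of the double
    family agree for them: their common value is [expR b + expR (b * cos s)].
    Subtracting half of the instance [s = 0] removes the constant [1]. *)
Lemma jacobi_anger b t : 0 <= b ->
  series (fun j => eps_coef R j * besselI j b * cos (j%:R * t)) @ \oo
    --> expR (b * cos t).
Proof.
move=> b0.
have S s : series (fun j => eps_coef R j * besselI j b * (1 + cos (j%:R * s))) @ \oo
    --> expR b + expR (b * cos s).
  pose w j := 1 + cos (j%:R * s).
  have w0 j : 0 <= w j by rewrite -lerBlDl sub0r cos_geN1.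
  apply/nneseries_EFinP => [n|].
    by rewrite !mulr_ge0 ?besselI_ge0// ?w0// /eps_coef; case: ifP.
  rewrite -(esum_by_difference b0 w0) esum_by_total//; apply/nneseries_EFinP => [n|].
    apply: mulr_ge0; first by rewrite divr_ge0 ?exprn_ge0 ?divr_ge0.
    by apply: sumr_ge0 => k _; rewrite mulr_ge0.
  rewrite (_ : (fun n => _) = exp_coeff b \+ exp_coeff (b * cos s)).
    rewrite seriesD; apply: cvgD; exact: is_cvg_series_exp_coeff.
  apply/funext => n; rewrite /exp_coeff /= -mulrDl mulrAC; congr (_ / _).
  under eq_bigr do rewrite mulrDr mulr1.
  rewrite big_split /= mulrDr; congr (_ + _).
    (* [2 ^+ n] as the case of zero angles *)
    have := sum_bin_cos n (0 : R) 0; rewrite cos0 !mulr1 => S0.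
    rewrite (_ : \sum_(k < n.+1) _ = 2 ^+ n).
      by rewrite -exprMn; congr (_ ^+ n); field.
    by rewrite -S0; apply: eq_bigr => k _; rewrite mulr0 addr0 cos0 mulr1.
  under eq_bigr => k _.
    rewrite natr_absz (_ : cos _ = cos (0 + (n%:R - k%:R * 2) * s)); last first.
      have kn : (k <= n)%N by rewrite -ltnS.
      have E : n%:R - k%:R * 2 = - (Posz k - Posz (n - k))%:~R :> R.
        by rewrite intrB -!pmulrn natrB//; ring.
      rewrite E add0r; case: ger0P => _; first by rewrite mulNr cosN.
      by rewrite intrN.
    over.
  by rewrite sum_bin_cos cos0 mulr1 -exprMn; congr (_ ^+ n); field.
have h : series (fun j => eps_coef R j * besselI j b * cos (j%:R * t)) =
   (series (fun j => eps_coef R j * besselI j b * (1 + cos (j%:R * t)))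
   - 2^-1 *: series (fun j => eps_coef R j * besselI j b * (1 + cos (j%:R * 0)))).
  apply/funext => n; rewrite /series /= !fctE scaler_sumr -sumrB.
  by apply: eq_bigr => j _; rewrite mulr0 cos0 /GRing.scale /=; field.
rewrite h (_ : expR (b * cos t) = expR b + expR (b * cos t) - 2^-1 *: (expR b + expR (b * cos 0))).
  apply: cvgB; first exact: S.
  exact: cvgZr (S 0).
by rewrite cos0 mulr1 /GRing.scale /=; field.
Qed.

End jacobi_anger.

(** * Termwise integration *)

Section termwise_integration.
Variable R : realType.
Local Notation mu := (@lebesgue_measure R).

Lemma continuous_integrable_itv (p q : R) (f : R -> R) : continuous f ->
  mu.-integrable `[p, q] (EFin \o f).
Proof.
move=> cf; apply: continuous_compact_integrable; first exact: segment_compact.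
exact: continuous_subspaceT.
Qed.

Lemma continuous_series (f : nat -> R -> R) (n : nat) :
  (forall n, continuous (f n)) -> continuous (fun t => series (f ^~ t) n).
Proof.
move=> cf; elim: n => [|n IH].
  rewrite (_ : (fun _ => _) = fun=> 0); first by move=> t; exact: cvg_cst.
  by apply/funext => t; rewrite /series /= big_geq.
rewrite (_ : (fun _ => _) = (fun t => series (f ^~ t) n) \+ f n).
  by move=> t; apply: cvgD; [exact: IH|exact: cf].
by apply/funext => t; rewrite /series /= big_nat_recr.
Qed.

Lemma Rintegral_series (p q : R) (f : nat -> R -> R) (n : nat) :
  (forall n, continuous (f n)) ->
  \int[mu]_(t in `[p, q]) series (f ^~ t) n =
  series (fun n => \int[mu]_(t in `[p, q]) f n t) n.
Proof.
move=> cf; elim: n => [|n IH].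
  rewrite /series /= big_geq// (eq_Rintegral _ (g := fun=> 0)).
    by rewrite Rintegral_cst//= mul0r.
  by move=> t _; rewrite big_geq.
rewrite [RHS]/series /= big_nat_recr//= -[X in _ = X + _]/(series _ n) -IH -RintegralD//.
- by apply: eq_Rintegral => t _; rewrite /series /= big_nat_recr.
- exact/continuous_integrable_itv/continuous_series.
- exact: continuous_integrable_itv.
Qed.

(** Dominated convergence: under a summable uniform bound the partial sums are
    dominated by a constant, which is integrable on a segment. *)
Lemma cvg_series_Rintegral (p q : R) (f : nat -> R -> R) (g : R -> R) (M : nat -> R) :
  (forall n, continuous (f n)) -> continuous g ->
  (forall n t, `|f n t| <= M n) -> cvgn (series M) ->
  (forall t, series (f ^~ t) @ \oo --> g t) ->
  series (fun n => \int[mu]_(t in `[p, q]) f n t) @ \oo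
    --> \int[mu]_(t in `[p, q]) g t.
Proof.
move=> cf cg fM cM fg.
have mc (h : R -> R) : continuous h -> measurable_fun `[p, q] (EFin \o h).
  move=> ch; apply/measurable_EFinP; apply: measurable_funTS.
  exact: continuous_measurable_fun.
have M0 n : 0 <= M n by exact: le_trans (fM n 0).
have ae1 : {ae mu, forall t, `[p, q]%classic t ->
    (series (f ^~ t) n)%:E @[n --> \oo] --> (g t)%:E}.
  by apply: aeW => t _; apply/cvg_EFin; [exact: nearW|exact: fg].
have iM : mu.-integrable `[p, q] (EFin \o cst (limn (series M))).
  by apply: continuous_integrable_itv => t; exact: cvg_cst.
have ae2 : {ae mu, forall t n, `[p, q]%classic t ->
    (`|(series (f ^~ t) n)%:E| <= (EFin \o cst (limn (series M))) t)%E}.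
  apply: aeW => t n _ /=; rewrite lee_fin.
  rewrite (le_trans (ler_norm_sum _ _ _))//.
  rewrite (@le_trans _ _ (series M n))//; first exact: ler_sum.
  by apply: nondecreasing_cvgn_le => //; exact: nondecreasing_series.
have [_ _] := @dominated_convergence _ _ R mu `[p, q] (measurable_itv _)
  (fun n t => (series (f ^~ t) n)%:E) (EFin \o g) _
  (fun n => mc _ (continuous_series (n := n) cf)) (mc _ cg) ae1 iM ae2.
move=> H; rewrite (_ : series _ = fine \o (fun n => \int[mu]_(t in `[p, q]) (series (f ^~ t) n)%:E)%E).
  apply: fine_cvg; rewrite /Rintegral fineK//.
  exact/integrable_fin_num/continuous_integrable_itv.
by apply/funext => n; rewrite /= -Rintegral_series.
Qed.

(** Only even frequencies are considered: the segment has length [pi], a whole number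
    of their periods. *)
Lemma Rintegral_cos (j : nat) (th : R) :
  \int[mu]_(t in `[- (pi / 2), pi / 2]) cos ((2 * j)%:R * t + th) =
  (j == 0)%:R * pi * cos th.
Proof.
have pi20 : - (pi / 2) < pi / 2 :> R by rewrite gtrN ?divr_gt0 ?pi_gt0.
have [->|j0] := eqVneq.
  rewrite (eq_Rintegral _ (g := cst (cos th))); last first.
    by move=> t _; rewrite muln0 mul0r add0r.
  rewrite Rintegral_cst//= lebesgue_measure_itv/= lte_fin pi20 -EFinD /=.
  by rewrite mul1r mulrC; field.
rewrite !mul0r.
pose F (t : R) := sin ((2 * j)%:R * t + th) / (2 * j)%:R.
have dF (t : R) : is_derive t 1 F (cos ((2 * j)%:R * t + th)).
  apply: is_derive_eq; rewrite /GRing.scale /=.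
  by rewrite mulr0 add0r mulr1 addr0 mulrC -mulrA divff ?mulr1// pnatr_eq0 muln_eq0.
have cF : continuous F.
  by move=> t; apply: differentiable_continuous; apply/derivable1_diffP; exact: ex_derive.
rewrite /Rintegral (@continuous_FTC2 _ _ F)//=.
- rewrite /F (_ : _ * (pi / 2) + th = (2 * j)%:R * - (pi / 2) + th + pi *+ 2 *+ j).
    by rewrite ((@periodicn _ _ _ _ (@sinD2pi R))) subrr.
  by rewrite -[pi *+ 2 *+ j]mulr_natr -[pi *+ 2]mulr_natr natrM; field.
- apply: continuous_subspaceT => t; apply: continuous_comp; last exact: continuous_cos.
  apply: cvgD; last exact: cvg_cst.
  by apply: cvgM; [exact: cvg_cst|exact: cvg_id].
- split => [t _||]; first exact: ex_derive.
  + by apply: cvg_at_right_filter; exact: cF.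
  + by apply: cvg_at_left_filter; exact: cF.
- by move=> t _; rewrite derive1E derive_val.
Qed.

End termwise_integration.

(** * Half-turn mean of a product of exponentials of cosines *)

Section bessel_product.
Variable R : realType.
Local Notation mu := (@lebesgue_measure R).

Lemma cvg_series_even (u : nat -> R) (l : R) :
  (forall n, odd n -> u n = 0) -> series u @ \oo --> l ->
  series (fun n => u (2 * n)%N) @ \oo --> l.
Proof.
move=> u0 ul.
rewrite (_ : series _ = (series u) \o (fun n => 2 * n)%N).
  apply: cvg_comp ul; apply/cvgnyPge => A; near=> n.
  by rewrite (@leq_trans n)//; [near: n; exact: nbhs_infty_ge|lia].
apply/funext => n /=; elim: n => [|n IH]; first by rewrite muln0 /series /= !big_geq.
rewrite [LHS]/series /= big_nat_recr//= -[X in X + _]/(series _ n) IH.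
rewrite mulnS add2n [RHS]/series /= !big_nat_recr//= [u (2 * n).+1]u0 ?addr0//.
by rewrite /= mul2n odd_double.
Unshelve. all: by end_near. Qed.

Lemma cvg_series_single (i : nat) (c : R) :
  series (fun j => (j == i)%:R * c) @ \oo --> c.
Proof.
apply: cvg_near_cst; near=> n.
have ni : (i < n)%N by near: n; exact: nbhs_infty_gt.
rewrite /series /= big_mkord (bigD1 (Ordinal ni))//= eqxx mul1r big1 ?addr0//.
by move=> j /eqP ji; case: eqP => [jE|_]; [case: ji; exact: val_inj|rewrite mul0r].
Unshelve. all: by end_near. Qed.

Lemma cosDpin (t : R) (n : nat) : cos (t + n%:R * pi) = (-1) ^+ n * cos t.
Proof.
elim: n => [|n IH]; first by rewrite mul0r addr0 expr0 mul1r.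
by rewrite -natr1 mulrDl mul1r addrA cosDpi IH exprS mulN1r mulNr.
Qed.

(** Averaging the expansions at [t] and [t + pi] cancels the odd orders. *)
Lemma jacobi_anger_even (a t : R) : 0 <= a ->
  series (fun j => eps_coef R j * besselI (2 * j) a * cos ((2 * j)%:R * t)) @ \oo
    --> (expR (a * cos t) + expR (- (a * cos t))) / 2.
Proof.
move=> a0.
pose u n := eps_coef R n * besselI n a * cos (n%:R * t).
pose u' n := eps_coef R n * besselI n a * cos (n%:R * (t + pi)).
have u'E n : u' n = (-1) ^+ n * u n.
  by rewrite /u' mulrDr cosDpin mulrCA.
pose v n := (u n + u' n) / 2.
have vl : series v @ \oo --> (expR (a * cos t) + expR (- (a * cos t))) / 2.
  rewrite (_ : series v = 2^-1 *: (series u + series u')).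
    rewrite mulrC; apply: cvgZr; apply: cvgD; first exact: jacobi_anger.
    by rewrite -mulrN -cosDpi; exact: jacobi_anger.
  by rewrite -seriesD -seriesZ; congr series; apply/funext => n; rewrite /v mulrC.
rewrite (_ : (fun j => _) = fun j => v (2 * j)%N).
  apply: cvg_series_even vl => n on.
  by rewrite /v u'E -signr_odd on expr1 mulN1r subrr mul0r.
apply/funext => j; rewrite /v u'E -signr_odd mul2n odd_double expr0 mul1r /u.
rewrite (_ : eps_coef R j.*2 = eps_coef R j); last by rewrite /eps_coef double_eq0.
by field.
Qed.

(** Orthogonality of the even frequencies, with a phase [d] in one factor. *)
Lemma Rintegral_cosM (i j : nat) (v0 d : R) :
  \int[mu]_(t in `[- (pi / 2), pi / 2])
    (cos ((2 * j)%:R * (t + v0)) * cos ((2 * i)%:R * (t + v0 - d))) =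
  (j == i)%:R * (pi / eps_coef R i * cos ((2 * i)%:R * d)).
Proof.
(* [m] is the absolute difference of [i] and [j] and [s] the phase that goes with it;
   [Rintegral_cos] only speaks of frequencies in [nat]. *)
have [m [s [mij sE]]] : exists m : nat, exists s : R, ((m == 0) = (j == i))%N /\
   forall t, cos ((2 * m)%:R * t + s) = cos ((2 * j)%:R * (t + v0) - (2 * i)%:R * (t + v0 - d)) .
  have [ij|ji] := leqP i j.
    exists (j - i)%N, ((2 * j)%:R * v0 - (2 * i)%:R * (v0 - d)); split; first lia.
    by move=> t; congr cos; rewrite mulnBr natrB; [ring|lia].
  exists (i - j)%N, (- ((2 * j)%:R * v0 - (2 * i)%:R * (v0 - d))); split; first lia.
  by move=> t; rewrite -[RHS]cosN; congr cos; rewrite mulnBr natrB; [ring|lia].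
pose s' := (2 * j)%:R * v0 + (2 * i)%:R * (v0 - d).
have cc (n : nat) c : continuous (fun t : R => 2^-1 * cos ((2 * n)%:R * t + c)).
  move=> t; apply: cvgM; first exact: cvg_cst.
  apply: continuous_comp; last exact: continuous_cos.
  by apply: cvgD; [apply: cvgM; [exact: cvg_cst|exact: cvg_id]|exact: cvg_cst].
transitivity (\int[mu]_(t in `[- (pi / 2), pi / 2])
   (2^-1 * cos ((2 * (j + i))%:R * t + s') + 2^-1 * cos ((2 * m)%:R * t + s))).
  apply: eq_Rintegral => t _ /=; rewrite sE cosB.
  rewrite (_ : (2 * (j + i))%:R * t + s' = (2 * j)%:R * (t + v0) + (2 * i)%:R * (t + v0 - d)).
    by rewrite cosD; field.
  by rewrite /s' mulnDr natrD; ring.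
rewrite RintegralD//; [|exact: continuous_integrable_itv..].
have ci (n : nat) c : mu.-integrable `[- (pi / 2), pi / 2]
   (EFin \o (fun t : R => cos ((2 * n)%:R * t + c))).
  apply: continuous_integrable_itv => t.
  apply: continuous_comp; last exact: continuous_cos.
  by apply: cvgD; [apply: cvgM; [exact: cvg_cst|exact: cvg_id]|exact: cvg_cst].
rewrite !RintegralZl// !Rintegral_cos mij.
have [ji|ji] := eqVneq j i; last first.
  rewrite (_ : (j + i == 0)%N = false) ?mul0r ?mulr0 ?addr0//.
  by apply/negbTE; move: ji; rewrite -!lt0n; lia.
have csE : cos s = cos ((2 * i)%:R * d).
  by have := sE 0; rewrite mulr0 add0r ji => ->; congr cos; ring.
rewrite csE ji; have [i0|i0] := eqVneq i 0%N.
  by rewrite /eps_coef /s' ji i0 !muln0 !mul0r !addr0 cos0 /=; field.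
rewrite /eps_coef (negbTE i0) (_ : (i + i == 0)%N = false).
  by rewrite /= mulr0n mulr1n !mul0r mulr0 add0r; field.
lia.
Qed.

Lemma eps_coef_ge0 j : 0 <= eps_coef R j.
Proof. by rewrite /eps_coef; case: ifP. Qed.

(** The hyperbolic cosine of [a * cos v]. *)
Definition cosh_cos (a v : R) : R := (expR (a * cos v) + expR (- (a * cos v))) / 2.

Lemma continuous_cos_affine (k c : R) : continuous (fun t : R => cos (k * (t + c))).
Proof.
move=> t; apply: continuous_comp; last exact: continuous_cos.
apply: cvgM; first exact: cvg_cst.
by apply: cvgD; [exact: cvg_id|exact: cvg_cst].
Qed.

Lemma continuous_expR_cos (a k c : R) :
  continuous (fun t : R => expR (a * cos (k * (t + c)))).
Proof.
move=> t; apply: continuous_comp; last exact: continuous_expR.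
by apply: cvgM; [exact: cvg_cst|exact: continuous_cos_affine].
Qed.

Lemma continuous_cosh_cos (a c : R) : continuous (fun t : R => cosh_cos a (t + c)).
Proof.
move=> t; rewrite /cosh_cos; apply: cvgM; last exact: cvg_cst.
have E s : s + c = 1 * (s + c) by rewrite mul1r.
under eq_fun do rewrite E -mulNr.
by rewrite E -mulNr; apply: cvgD; exact: continuous_expR_cos.
Qed.

Lemma cosh_cos_norm_le (a v : R) : 0 <= a -> `|cosh_cos a v| <= expR a.
Proof.
move=> a0; rewrite ger0_norm; last by rewrite divr_ge0// addr_ge0// expR_ge0.
have h c : -1 <= c <= 1 -> expR (a * c) <= expR a.
  by move=> /andP[_ c1]; rewrite ler_expR ler_piMr.
have h1 := h _ (introT andP (conj (cos_geN1 v) (cos_le1 v))).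
have := h (- cos v); rewrite lerN2 lerNl cos_le1 cos_geN1 mulrN => /(_ isT) h2.
by rewrite /cosh_cos; lra.
Qed.

(** Integrating the expansion [jacobi_anger_even] term by term: orthogonality leaves
    the term of index [i] alone. *)
Lemma fourier_coef_cosh_cos (a v0 d : R) (i : nat) : 0 <= a ->
  \int[mu]_(t in `[- (pi / 2), pi / 2])
    (cosh_cos a (t + v0) * cos ((2 * i)%:R * (t + v0 - d))) =
  besselI (2 * i) a * pi * cos ((2 * i)%:R * d).
Proof.
move=> a0.
pose A j := eps_coef R j * besselI (2 * j) a.
have A0 j : 0 <= A j by rewrite mulr_ge0 ?eps_coef_ge0 ?besselI_ge0.
pose f j t := A j * cos ((2 * j)%:R * (t + v0)) * cos ((2 * i)%:R * (t + v0 - d)).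
have cf j : continuous (f j).
  move=> t; apply: cvgM.
    by apply: cvgM; [exact: cvg_cst|exact: continuous_cos_affine].
  under eq_fun do rewrite -addrA.
  by rewrite -addrA; exact: continuous_cos_affine.
have cg : continuous (fun t => cosh_cos a (t + v0) * cos ((2 * i)%:R * (t + v0 - d))).
  move=> t; apply: cvgM; first exact: continuous_cosh_cos.
  under eq_fun do rewrite -addrA.
  by rewrite -addrA; exact: continuous_cos_affine.
have fM j t : `|f j t| <= A j.
  rewrite /f -mulrA normrM ger0_norm// ler_piMr// normrM.
  by rewrite mulr_ile1 ?cos_max.
have cM : cvgn (series A).
  have := @jacobi_anger_even a 0 a0; under eq_fun do rewrite mulr0 cos0 mulr1.
  by move=> h; apply/cvg_ex; eexists; exact: h.
have fg t : series (f ^~ t) @ \oo -->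
    cosh_cos a (t + v0) * cos ((2 * i)%:R * (t + v0 - d)).
  rewrite (_ : series _ = cos ((2 * i)%:R * (t + v0 - d)) *:
     series (fun j => A j * cos ((2 * j)%:R * (t + v0)))).
    by rewrite [X in _ --> X]mulrC; apply: cvgZr; exact: jacobi_anger_even.
  by rewrite -seriesZ; congr series; apply/funext => j; rewrite /f mulrC.
have H := @cvg_series_Rintegral R (- (pi / 2)) (pi / 2) f _ A cf cg fM cM fg.
apply: (cvg_unique _ H) => //.
rewrite (_ : (fun n => _) = fun j => (j == i)%:R * (besselI (2 * i) a * pi * cos ((2 * i)%:R * d))).
  exact: cvg_series_single.
apply/funext => j; rewrite /f.
under eq_Rintegral do rewrite -mulrA.
rewrite RintegralZl//; last first.
  apply: continuous_integrable_itv => t; apply: cvgM.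
    exact: continuous_cos_affine.
  under eq_fun do rewrite -addrA.
  by rewrite -addrA; exact: continuous_cos_affine.
rewrite Rintegral_cosM; have [->|_] := eqVneq j i; last by rewrite !mul0r mulr0.
by rewrite /A /eps_coef; case: ifP => _; field.
Qed.

(** Expand the second exponential with [jacobi_anger] and integrate term by term; each
    term is a Fourier coefficient of [cosh_cos a]. *)
Lemma bessel_product_integral (a b v0 d : R) : 0 <= a -> 0 <= b ->
  series (fun j => eps_coef R j * besselI (2 * j) a * besselI j b * cos ((2 * j)%:R * d))
    @ \oo --> pi^-1 * \int[mu]_(t in `[- (pi / 2), pi / 2])
      (cosh_cos a (t + v0) * expR (b * cos (2 * (t + v0 - d)))).
Proof.
move=> a0 b0.
pose B i := eps_coef R i * besselI i b.
have B0 i : 0 <= B i by rewrite mulr_ge0 ?eps_coef_ge0 ?besselI_ge0.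
pose f i t := B i * (cosh_cos a (t + v0) * cos ((2 * i)%:R * (t + v0 - d))).
have cg0 i : continuous (fun t => cosh_cos a (t + v0) * cos ((2 * i)%:R * (t + v0 - d))).
  move=> t; apply: cvgM; first exact: continuous_cosh_cos.
  under eq_fun do rewrite -addrA.
  by rewrite -addrA; exact: continuous_cos_affine.
have cf i : continuous (f i).
  by move=> t; apply: cvgM; [exact: cvg_cst|exact: cg0].
have cg : continuous (fun t => cosh_cos a (t + v0) * expR (b * cos (2 * (t + v0 - d)))).
  move=> t; apply: cvgM; first exact: continuous_cosh_cos.
  under eq_fun do rewrite -addrA.
  by rewrite -addrA; exact: continuous_expR_cos.
have fM i t : `|f i t| <= expR a * B i.
  rewrite /f normrM ger0_norm// mulrC ler_wpM2r// normrM.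
  rewrite -[leRHS]mulr1 ler_pM// ?cos_max//; exact: cosh_cos_norm_le.
have cM : cvgn (series (fun i => expR a * B i)).
  have := @jacobi_anger R b 0 b0; under eq_fun do rewrite mulr0 cos0 mulr1.
  by move=> h; apply: (is_cvg_seriesZ (k := expR a)); apply/cvg_ex; eexists; exact: h.
have fg t : series (f ^~ t) @ \oo -->
    cosh_cos a (t + v0) * expR (b * cos (2 * (t + v0 - d))).
  rewrite (_ : series _ = cosh_cos a (t + v0) *:
     series (fun i => B i * cos (i%:R * (2 * (t + v0 - d))))).
    by apply: cvgZr; exact: jacobi_anger.
  rewrite -seriesZ; congr series; apply/funext => i.
  rewrite /f natrM mulrCA /GRing.scale /=; congr (_ * (_ * cos _)); ring.
have H := @cvg_series_Rintegral R (- (pi / 2)) (pi / 2) f _ _ cf cg fM cM fg.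
rewrite (_ : series _ = pi^-1 *: series (fun i => \int[mu]_(t in `[- (pi / 2), pi / 2]) f i t)).
  exact: cvgZr H.
rewrite -seriesZ; congr series; apply/funext => i.
rewrite /f fctE RintegralZl//; last exact: continuous_integrable_itv.
rewrite fourier_coef_cosh_cos//; move: pi (lt0r_neq0 (pi_gt0 R)) => p p0.
by rewrite /GRing.scale /= /B; field.
Qed.

End bessel_product.

(** * Polar coordinates *)

Section polar_coordinates.
Variable R : realType.
Local Notation mu := (@lebesgue_measure R).
Local Open Scope ereal_scope.

Lemma scale_preimage_itvoc (k a b : R) : (0 < `|k|)%R ->
  `|k|%:E * mu ( *%R k @^-1` `]a, b]%classic) = mu `]a, b]%classic.
Proof.
move=> k0.
have [kp|kn] := ltP 0%R k.
  rewrite (_ : _ @^-1` _ = `](a / k)%R, (b / k)%R]%classic); last first.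
    by apply/seteqP; split => x /=; rewrite !in_itv/= ltr_pdivrMr// ler_pdivlMr// mulrC.
  rewrite !lebesgue_measure_itv/= !lte_fin ltr_pM2r ?invr_gt0//.
  rewrite gtr0_norm//; case: ifP; last by rewrite mule0.
  by move=> _; rewrite -!EFinD -EFinM; congr EFin; field; rewrite gt_eqF.
have {}kn : (k < 0)%R by rewrite lt_neqAle kn andbT -normr_gt0.
rewrite (_ : _ @^-1` _ = `[(b / k)%R, (a / k)%R[%classic); last first.
  by apply/seteqP; split => x /=; rewrite !in_itv/= ler_ndivrMr// ltr_ndivlMr// [(x * k)%R]mulrC andbC.
rewrite !lebesgue_measure_itv/= !lte_fin ltr_nM2r ?invr_lt0//.
rewrite ltr0_norm//; case: ifP; last by rewrite mule0.
by move=> _; rewrite -!EFinD -EFinM; congr EFin; field; rewrite lt_eqF.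
Qed.

(** Lebesgue measure is the only measure with the right values on the intervals
    [`]a, b]], and these are those of its rescaled image. *)
Lemma ge0_integral_scale (k : R) (f : R -> \bar R) : k != 0%R ->
  measurable_fun setT f -> (forall y, 0 <= f y) ->
  \int[mu]_y f y = `|k|%:E * \int[mu]_x f (k * x)%R.
Proof.
move=> k0 mf f0.
have mk : measurable_fun setT ( *%R k : R -> measurableTypeR R).
  exact: measurable_funM.
unshelve epose (nu := (pushforward mu ( *%R k : R -> measurableTypeR R)
  : {measure set (measurableTypeR R) -> \bar R})); first exact: mk.
have nk0 : (0 <= `|k|)%R by [].
transitivity (\int[mscale (NngNum nk0) nu]_y f y).
  apply: eq_measure_integral => A mA _.
  apply: lebesgue_measure_unique => //= _ [[a b]] _ <-.
  by apply/esym/scale_preimage_itvoc; rewrite normr_gt0.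
rewrite ge0_integral_mscale//; congr (_ * _).
by rewrite ge0_integral_pushforward//= preimage_setT.
Qed.

(** [g] in the coordinates [z = (r, m)], with [r] the signed distance to the origin and
    [m] the slope; the Jacobian is [`|r| * cos (atan m) ^+ 2], and the factor [`|r|] is
    kept outside. *)
Definition polar_integrand (g : R * R -> \bar R) (z : R * R) : \bar R :=
  (cos (atan z.2) ^+ 2)%:E * g (z.1 * cos (atan z.2), z.1 * sin (atan z.2))%R.

Lemma continuous_cos_atan : continuous (fun m : R => cos (atan m)).
Proof. by move=> m; apply: continuous_comp; [exact: continuous_atan|exact: continuous_cos]. Qed.

Lemma continuous_sin_atan : continuous (fun m : R => sin (atan m)).
Proof. by move=> m; apply: continuous_comp; [exact: continuous_atan|exact: continuous_sin]. Qed.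

Lemma measurable_polar_integrand (g : R * R -> \bar R) :
  measurable_fun setT g -> measurable_fun setT (polar_integrand g).
Proof.
move=> mg.
have mcos := continuous_measurable_fun continuous_cos_atan.
have msin := continuous_measurable_fun continuous_sin_atan.
apply: emeasurable_funM.
  apply/measurable_EFinP; apply: measurable_funX.
  exact: measurableT_comp mcos measurable_snd.
apply: measurableT_comp mg _; apply: measurable_fun_pair.
  apply: measurable_funM; first exact: measurable_fst.
  exact: measurableT_comp mcos measurable_snd.
apply: measurable_funM; first exact: measurable_fst.
exact: measurableT_comp msin measurable_snd.
Qed.

Lemma polar_integrand_ge0 (g : R * R -> \bar R) z :
  (forall z, 0 <= g z) -> 0 <= polar_integrand g z.
Proof. by move=> g0; rewrite mule_ge0// lee_fin sqr_ge0. Qed.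

(** Substitute [y = x m] for fixed [x], exchange the integrals, substitute
    [x = r cos (atan m)] for fixed [m], and exchange again.  Both substitutions are
    scalings, which [ge0_integral_scale] covers for every measurable [g]. *)
Lemma polar_tan (g : R * R -> \bar R) :
  measurable_fun setT g -> (forall z, 0 <= g z) ->
  \int[mu \x mu]_z g z =
  \int[mu]_r (`|r|%:E * \int[mu]_m polar_integrand g (r, m)).
Proof.
move=> mg g0.
have cos_gt0 (m : R) : (0 < cos (atan m))%R.
  by apply: cos_gt0_pihalf; rewrite atan_gtNpi2 atan_ltpi2.
have cosm (m : R) : (cos (atan m) * m = sin (atan m))%R.
  by rewrite -{2}[m]atanK /tan mulrC divfK// gt_eqF.
have mnorm1 : measurable_fun [set: R * R] (fun z : R * R => `|z.1|%:E).
  apply/measurable_EFinP; apply: measurableT_comp => //; exact: measurable_fst.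
have mpair (x : R) : measurable_fun setT (fun y : R => (x, y)).
  by apply: measurable_fun_pair.
(* The integrands in the coordinates [(x, m)] and [(r, m)]. *)
pose g1 (z : R * R) := `|z.1|%:E * g (z.1, z.1 * z.2)%R.
have g10 z : 0 <= g1 z by rewrite mule_ge0.
have mg1 : measurable_fun setT g1.
  apply: emeasurable_funM => //; apply: measurableT_comp mg _.
  apply: measurable_fun_pair; first exact: measurable_fst.
  by apply: measurable_funM; [exact: measurable_fst|exact: measurable_snd].
pose g2 (z : R * R) := `|z.1|%:E * polar_integrand g z.
have g20 z : 0 <= g2 z by rewrite mule_ge0// polar_integrand_ge0.
have mg2 : measurable_fun setT g2.
  by apply: emeasurable_funM => //; exact: measurable_polar_integrand.
transitivity (\int[mu]_x \int[mu]_m g1 (x, m)).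
  rewrite fubini_tonelli1//; apply: ge0_ae_eq_integral => //.
  - exact: measurable_fun_fubini_tonelli_F.
  - exact: measurable_fun_fubini_tonelli_F.
  - by move=> x _; apply: integral_ge0.
  - by move=> x _; apply: integral_ge0.
  exists [set 0%R]; split => //; first exact: lebesgue_measure_set1.
  move=> x /=; apply: contra_notP => /eqP x0 _.
  rewrite /fubini_F (ge0_integral_scale x0)//; last exact: measurableT_comp.
  rewrite -ge0_integralZl//; apply: measurableT_comp mg _.
  by apply: measurable_fun_pair => //; exact: measurable_funM.
transitivity (\int[mu]_m \int[mu]_x g1 (x, m)); first exact: fubini_tonelli.
transitivity (\int[mu]_m \int[mu]_r g2 (r, m)).
  apply: eq_integral => m _.
  have m1 : measurable_fun setT (fun x : R => g1 (x, m)).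
    apply: measurableT_comp mg1 _; exact: measurable_fun_pair.
  rewrite (@ge0_integral_scale (cos (atan m)))//; last by rewrite gt_eqF.
  rewrite -ge0_integralZl//; last first.
    by apply: measurableT_comp m1 _; exact: measurable_funM.
  apply: eq_integral => r _; rewrite /g1 /g2 /polar_integrand /=.
  rewrite normrM (gtr0_norm (cos_gt0 m)) muleA -!EFinM muleA -EFinM.
  rewrite mulrAC cosm [(sin _ * r)%R]mulrC [(cos _ * r)%R]mulrC.
  by congr (_%:E * _); ring.
transitivity (\int[mu]_r \int[mu]_m g2 (r, m)).
  exact/esym/fubini_tonelli.
apply: eq_integral => r _.
rewrite -ge0_integralZl//.
  apply: measurableT_comp (mpair r); exact: measurable_polar_integrand.
by move=> m _; exact: polar_integrand_ge0.
Qed.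

(** The substitution [t = atan m] on the segments [[-n, n]], passing to the limit by
    monotone convergence on both sides. *)
Lemma ge0_integral_atan (h : R -> R) : continuous h -> (forall t, (0 <= h t)%R) ->
  \int[mu]_m (cos (atan m) ^+ 2 * h (atan m))%:E =
  \int[mu]_(t in `[(- (pi / 2))%R, (pi / 2)%R]) (h t)%:E.
Proof.
move=> ch h0.
have matan := le_mono (@lt_atan R).
pose G m := (cos (atan m) ^+ 2 * h (atan m))%R.
have catan : continuous (@atan R) by move=> m; exact: continuous_atan.
have ccos := continuous_cos_atan.
have cG : continuous G.
  move=> m; apply: cvgM; last by apply: continuous_comp; [exact: catan|exact: ch].
  by apply: cvgM; exact: ccos.
have cos2E (m : R) : (cos (atan m) ^+ 2 = (1 + m ^+ 2)^-1)%R.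
  by rewrite cos_atan exprVn sqr_sqrtr// addr_ge0// sqr_ge0.
have datan : derive1 (@atan R) = (fun m => cos (atan m) ^+ 2)%R.
  by apply/funext => m; rewrite derive1_atan cos2E.
have cdatan : continuous (derive1 (@atan R)).
  by rewrite datan => m; apply: cvgM; exact: ccos.
pose E1 n := `[(- n%:R)%R, n%:R%R]%classic : set R.
pose E2 n := `[atan (- n%:R)%R, atan n%:R%R]%classic : set R.
have E n : \int[mu]_(m in E1 n) (G m)%:E = \int[mu]_(t in E2 n) (h t)%:E.
  rewrite /E2 (integration_by_substitution_increasing (F := @atan R)) //.
  - by apply: eq_integral => m _; rewrite /G /= datan fctE mulrC.
  - by rewrite (@le_trans _ _ 0%R)// oppr_le0.
  - by move=> x y _ _; exact: lt_atan.
  - by apply/cvg_ex; eexists; apply: cvg_at_right_filter; exact: cdatan.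
  - by apply/cvg_ex; eexists; apply: cvg_at_left_filter; exact: cdatan.
  - split => [x _||]; first exact: derivable_atan.
    + by apply: cvg_at_right_filter; exact: catan.
    + by apply: cvg_at_left_filter; exact: catan.
  - exact: continuous_subspaceT.
have L1 : \int[mu]_(m in E1 n) (G m)%:E @[n --> \oo] --> \int[mu]_m (G m)%:E.
  rewrite [X in _ --> X](_ : _ = \int[mu]_(m in \bigcup_n E1 n) (G m)%:E); last first.
    congr integral; apply/esym/seteqP; split => // x _.
    exists (Num.truncn `|x|).+1 => //=.
    rewrite /E1 /= in_itv/= -ler_norml ltW//; exact: truncnS_gt.
  apply: ge0_nondecreasing_set_cvg_integral => //.
  - apply/nondecreasing_seqP => n; rewrite subsetEset => x; rewrite /E1 /= !in_itv/= -!ler_norml.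
    by move=> /le_trans; apply; rewrite ler_nat.
  - by move=> n; exact: measurable_itv.
  - move=> n; apply/measurable_EFinP; apply: measurable_funTS.
    exact: continuous_measurable_fun.
  - by move=> n x _; rewrite lee_fin mulr_ge0// sqr_ge0.
have L2 : \int[mu]_(t in E2 n) (h t)%:E @[n --> \oo] -->
    \int[mu]_(t in `](- (pi / 2))%R, (pi / 2)%R[) (h t)%:E.
  rewrite [X in _ --> X](_ : _ = \int[mu]_(t in \bigcup_n E2 n) (h t)%:E); last first.
    congr integral; apply/esym/seteqP; split => x /=.
      move=> [n _]; rewrite /E2 /= !in_itv/= => /andP[x1 x2].
      by rewrite (lt_le_trans (atan_gtNpi2 _) x1) (le_lt_trans x2 (atan_ltpi2 _)).
    move=> xpi; exists (Num.truncn `|tan x|).+1 => //=.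
    have : (`|tan x| <= (Num.truncn `|tan x|).+1%:R)%R by rewrite ltW// truncnS_gt.
    rewrite ler_norml => /andP[t1 t2]; rewrite /E2 /= in_itv/=.
    by move: t1 t2; rewrite -matan -[(tan x <= _)%R]matan tanK// => -> ->.
  apply: ge0_nondecreasing_set_cvg_integral => //.
  - apply/nondecreasing_seqP => n; rewrite subsetEset => x; rewrite /E2 /= !in_itv/= => /andP[x1 x2].
    apply/andP; split; [apply: le_trans x1|apply: le_trans x2 _];
    by rewrite matan ?lerN2 ler_nat.
  - by move=> n; exact: measurable_itv.
  - move=> n; apply/measurable_EFinP; apply: measurable_funTS.
    exact: continuous_measurable_fun.
  - by move=> n x _; rewrite lee_fin.
transitivity (\int[mu]_(t in `](- (pi / 2))%R, (pi / 2)%R[) (h t)%:E).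
  move/funext : E L1 => -> L1; exact: (cvg_unique _ L1 L2).
apply/esym; apply: integral_itv_bndoo.
apply/measurable_EFinP; apply: measurable_funTS; exact: continuous_measurable_fun.
Qed.

Lemma measurable_norm_preimage (A : set R) : measurable A ->
  measurable [set z : R * R | A (Num.sqrt (z.1 ^+ 2 + z.2 ^+ 2))%R].
Proof.
move=> mA; rewrite -[X in measurable X]setTI.
suff : measurable_fun setT (fun z : R * R => Num.sqrt (z.1 ^+ 2 + z.2 ^+ 2)%R).
  by apply.
apply: measurableT_comp.
  exact: (continuous_measurable_fun (@sqrt_continuous R)).
by apply: measurable_funD; apply: measurable_funX;
  [exact: measurable_fst|exact: measurable_snd].
Qed.

(** Polar coordinates for an event that only depends on the radius.  In [polar_tan]
    the radius is signed and the direction ranges over half a turn; folding the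
    negative radii onto the positive ones pairs each point with its antipode. *)
Lemma polar_norm (A : set R) (h : R * R -> R) :
  measurable A -> measurable_fun setT h -> (forall z, (0 <= h z)%R) ->
  (forall r : R, continuous (fun t : R => h (r * cos t, r * sin t)%R)) ->
  \int[mu \x mu]_(z in [set z | A (Num.sqrt (z.1 ^+ 2 + z.2 ^+ 2)%R)]) (h z)%:E =
  \int[mu]_(r in A `&` `]0%R, +oo[) (r%:E *
    \int[mu]_(t in `[(- (pi / 2))%R, (pi / 2)%R])
      (h (r * cos t, r * sin t) + h (- r * cos t, - r * sin t))%:E).
Proof.
move=> mA mh h0 ch.
pose D := [set z : R * R | A (Num.sqrt (z.1 ^+ 2 + z.2 ^+ 2)%R)].
have mD : measurable D by exact: measurable_norm_preimage.
pose g : R * R -> \bar R := (EFin \o h) \_ D.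
have mg : measurable_fun setT g.
  by apply/(measurable_restrictT _ mD); apply: measurable_funTS; exact/measurable_EFinP.
have g0 z : 0 <= g z by apply: erestrict_ge0 => ? _; rewrite lee_fin.
pose H r := \int[mu]_(t in `[(- (pi / 2))%R, (pi / 2)%R]) (h (r * cos t, r * sin t)%R)%:E.
have H0 r : 0 <= H r by apply: integral_ge0 => t _; rewrite lee_fin.
pose K r := `|r|%:E * \int[mu]_m polar_integrand g (r, m).
have K0 r : 0 <= K r.
  by rewrite mule_ge0//; apply: integral_ge0 => m _; exact: polar_integrand_ge0.
have mK : measurable_fun setT K.
  apply: emeasurable_funM.
    by apply/measurable_EFinP; exact: normr_measurable.
  apply: (measurable_fun_fubini_tonelli_F (m2 := mu) (polar_integrand g)).
    exact: measurable_polar_integrand.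
  by move=> z; exact: polar_integrand_ge0.
have KE r : K r = if `|r|%R \in A then `|r|%:E * H r else 0.
  rewrite /K.
  have gE m : polar_integrand g (r, m) =
      if `|r|%R \in A then (cos (atan m) ^+ 2 * h (r * cos (atan m), r * sin (atan m)))%:E
      else 0.
    rewrite /polar_integrand /g patchE /= (_ : (_ \in D) = (`|r|%R \in A)).
      by case: ifP => _; rewrite ?mule0.
    have -> : `|r|%R = Num.sqrt ((r * cos (atan m)) ^+ 2 + (r * sin (atan m)) ^+ 2)%R.
      by rewrite !exprMn -mulrDr cos2Dsin2 mulr1 sqrtr_sqr.
    by apply/idP/idP; rewrite !inE.
  under eq_integral do rewrite gE.
  case: ifP => _; last by rewrite integral0 mule0.
  by rewrite (ge0_integral_atan (h := fun t => h (r * cos t, r * sin t)%R)).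
transitivity (\int[mu]_r K r).
  by rewrite integral_mkcond; exact: polar_tan.
clearbody K.
transitivity (\int[mu]_(r in `]0%R, +oo[) (K r + K (- r)%R)).
  have -> : [set: R] = `]-oo, 0%R] `|` `]0%R, +oo[.
    by rewrite -itv_bndbnd_setU// set_itvE.
  rewrite ge0_integral_setU//; last 2 first.
  - exact: measurable_funTS.
  - rewrite disj_set2E; apply/eqP/seteqP; split => x //=.
    by rewrite !in_itv/= andbT => -[x0 /lt_geF]; rewrite x0.
  rewrite ge0_integralD//; last 2 first.
  - exact: measurable_funTS.
  - by apply: measurable_funTS; apply: measurableT_comp mK _; exact: oppr_measurable.
  rewrite addeC; congr (_ + _).
  rewrite integral_itv_obnd_cbnd; last first.
    by apply: measurable_funTS; apply: measurableT_comp mK _; exact: oppr_measurable.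
  rewrite ge0_integration_by_substitution0//.
    by apply: eq_integral => r _; rewrite opprK.
  by apply: measurableT_comp mK _; exact: oppr_measurable.
rewrite integral_mkcondl; apply: eq_integral => r.
rewrite inE /= in_itv/= andbT => r0.
rewrite !KE patchE normrN gtr0_norm//; case: ifP => _; last by rewrite adde0.
rewrite -ge0_muleDr//; congr (_ * _).
have mhr s : measurable_fun `[(- (pi / 2))%R, (pi / 2)%R]
    (fun t : R => (h (s * cos t, s * sin t)%R)%:E).
  by apply/measurable_EFinP; apply: measurable_funTS; exact: continuous_measurable_fun.
rewrite /H -ge0_integralD//.
- by move=> t _; rewrite lee_fin.
- exact: mhr.
- by move=> t _; rewrite lee_fin.
- exact: mhr.
Qed.

End polar_coordinates.

(** * The bivariate normal density in polar coordinates *)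

Section bivariate_normal_norm.
Variable R : realType.

Lemma det_mx22 (A : 'M[R]_2) : \det A = A 0 0 * A 1 1 - A 0 1 * A 1 0.
Proof.
rewrite (expand_det_row _ 0) !big_ord_recl big_ord0 /cofactor !det_mx11 !mxE /=.
have -> : lift ord0 (ord0 : 'I_1) = 1 by exact/val_inj.
have -> : lift 1 (0 : 'I_1) = 0 by exact/val_inj.
by rewrite addn0 expr0 /bump /= expr1 mul1r addr0 mulN1r mulrN.
Qed.

Section constants.
Variables (mu1 mu2 s1 s2 rho phit phi : R).
Hypotheses (s1_gt0 : 0 < s1) (s2_gt0 : 0 < s2) (rho_lt1 : `|rho| < 1).

Let rho2_gt0 : 0 < 1 - rho ^+ 2.
Proof. by rewrite subr_gt0 -real_normK ?num_real// expr_lt1. Qed.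

(** The determinant of the covariance matrix. *)
Let K := s1 ^+ 2 * s2 ^+ 2 * (1 - rho ^+ 2).

Let K_gt0 : 0 < K.
Proof. by rewrite /K !mulr_gt0 ?exprn_gt0. Qed.

Lemma invmx_cov2 :
  invmx (cov2 s1 s2 rho) = \matrix_(i, j)
    ((if i == j then (if i == 0 then s2 ^+ 2 else s1 ^+ 2) else - (rho * s1 * s2)) / K).
Proof.
set B := (X in _ = X).
have AB : cov2 s1 s2 rho *m B = 1%:M.
  apply/matrixP => i j; rewrite !mxE !big_ord_recl big_ord0 !mxE.
  have [s10 s20 r0] : [/\ s1 != 0, s2 != 0 & 1 - rho ^+ 2 != 0] by rewrite !gt_eqF.
  by case: i => [[|[|//]] ?]; case: j => [[|[|//]] ?] /=; rewrite /K; field; rewrite ?s10 ?s20 ?r0.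
by rewrite -[RHS](mulKmx (proj1 (mulmx1_unit AB))) AB mulmx1.
Qed.

Lemma normal2_pdfE (x y : R) :
  normal2_pdf (cvec2 mu1 mu2) (cov2 s1 s2 rho) (x, y) =
  (2 * pi * (s1 * s2 * Num.sqrt (1 - rho ^+ 2)))^-1 *
  expR (- (s2 ^+ 2 * (x - mu1) ^+ 2 - 2 * rho * s1 * s2 * (x - mu1) * (y - mu2)
           + s1 ^+ 2 * (y - mu2) ^+ 2) / (2 * K)).
Proof.
rewrite /normal2_pdf det_mx22 invmx_cov2; congr (_^-1 * expR _).
  move: pi (pi_gt0 R) => p p0; rewrite !mxE /=.
  rewrite (_ : _ - _ = (2 * p * (s1 * s2)) ^+ 2 * (1 - rho ^+ 2)); last by ring.
  rewrite sqrtrM ?sqr_ge0// sqrtr_sqr ger0_norm ?mulrA//.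
  by rewrite !mulr_ge0// ltW.
rewrite !mxE !big_ord_recl !big_ord0 !mxE !big_ord_recl !big_ord0 !mxE /=.
by field; rewrite gt_eqF.
Qed.

(** When [den = 0] the angle is arbitrary, but [p] and [q] vanish with [den]. *)
Let polar_coeff (p q den ang : R) : den = Num.sqrt (p ^+ 2 + q ^+ 2) ->
  (den != 0 -> cos ang = p / den /\ sin ang = q / den) ->
  den * cos ang = p /\ den * sin ang = q.
Proof.
move=> denE; have [den0 _|den0 /(_ isT)[-> ->]] := eqVneq den 0.
  have /eqP : p ^+ 2 + q ^+ 2 == 0.
    have pq : 0 <= p ^+ 2 + q ^+ 2 by rewrite addr_ge0 ?sqr_ge0.
    by rewrite eq_le pq andbT -sqrtr_eq0 -denE den0.
  move=> /eqP; rewrite paddr_eq0 ?sqr_ge0// !sqrf_eq0 => /andP[/eqP -> /eqP ->].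
  by rewrite den0 !mul0r.
by split; field.
Qed.

Hypotheses (phitP : is_phit mu1 mu2 s1 s2 rho phit) (phiP : is_phi s1 s2 rho phi).

Let psi_phit :
  psi mu1 mu2 s1 s2 rho * cos phit = (mu2 * s1 ^+ 2 - rho * mu1 * s1 * s2) / K /\
  psi mu1 mu2 s1 s2 rho * sin phit = (mu1 * s2 ^+ 2 - rho * mu2 * s1 * s2) / K.
Proof.
have psiE : psi mu1 mu2 s1 s2 rho = phit_den mu1 mu2 s1 s2 rho / K.
  by rewrite /psi /phit_den; congr (Num.sqrt _ / _); ring.
have denE : phit_den mu1 mu2 s1 s2 rho = Num.sqrt
    ((mu2 * s1 ^+ 2 - rho * mu1 * s1 * s2) ^+ 2 +
     (mu1 * s2 ^+ 2 - rho * mu2 * s1 * s2) ^+ 2).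
  by rewrite /phit_den; congr Num.sqrt; ring.
have [<- <-] := polar_coeff denE phitP.
by rewrite psiE; split; rewrite mulrAC.
Qed.

Let eta_phi :
  eta s1 s2 rho * cos phi = (s2 ^+ 2 - s1 ^+ 2) / (4 * K) /\
  eta s1 s2 rho * sin phi = 2 * rho * s1 * s2 / (4 * K).
Proof.
have etaE : eta s1 s2 rho = phi_den s1 s2 rho / (4 * K).
  by rewrite /eta /phi_den /K; congr (Num.sqrt _ / _); ring.
have denE : phi_den s1 s2 rho = Num.sqrt
    ((s2 ^+ 2 - s1 ^+ 2) ^+ 2 + (2 * rho * s1 * s2) ^+ 2).
  by rewrite /phi_den; congr Num.sqrt; ring.
have [<- <-] := polar_coeff denE phiP.
by rewrite etaE; split; rewrite mulrAC.
Qed.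

(** Completing to single harmonics: the phases [phit] and [phi] are those of the linear
    and the quadratic part of the form. *)
Let quadratic_form_polar (r t : R) :
  - (s2 ^+ 2 * (r * cos t - mu1) ^+ 2
     - 2 * rho * s1 * s2 * (r * cos t - mu1) * (r * sin t - mu2)
     + s1 ^+ 2 * (r * sin t - mu2) ^+ 2) / (2 * K) =
  - ((mu1 ^+ 2 * s2 ^+ 2 + s1 ^+ 2 * mu2 ^+ 2 - 2 * rho * s1 * s2 * mu1 * mu2)
     / (2 * s1 ^+ 2 * s2 ^+ 2 * (1 - rho ^+ 2)))
  + (- beta s1 s2 rho * r ^+ 2
     + (psi mu1 mu2 s1 s2 rho * r * cos (t + (phit - pi / 2))
        + eta s1 s2 rho * r ^+ 2 *
          cos (2 * (t + (phit - pi / 2) - (phit - phi / 2))))).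
Proof.
have [psic psis] := psi_phit; have [etac etas] := eta_phi.
have -> : cos (t + (phit - pi / 2)) = sin t * cos phit + cos t * sin phit.
  by rewrite addrA cosBpihalf sinD.
have -> : cos (2 * (t + (phit - pi / 2) - (phit - phi / 2))) =
    - ((cos t ^+ 2 - sin t ^+ 2) * cos phi - 2 * sin t * cos t * sin phi).
  rewrite (_ : 2 * _ = (t + t) + phi - pi); last by field.
  by rewrite cosB cospi sinpi cosD cosD sinD; ring.
set ps := psi _ _ _ _ _ in psic psis *; set et := eta _ _ _ in etac etas *.
(* Homogenize with [cos t ^+ 2 + sin t ^+ 2 = 1], so that both sides become equal as
   polynomials in [cos t] and [sin t]. *)
transitivity (- ((mu1 ^+ 2 * s2 ^+ 2 + s1 ^+ 2 * mu2 ^+ 2 - 2 * rho * s1 * s2 * mu1 * mu2)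
     / (2 * s1 ^+ 2 * s2 ^+ 2 * (1 - rho ^+ 2)))
  + (- beta s1 s2 rho * r ^+ 2 * (cos t ^+ 2 + sin t ^+ 2)
     + (r * (sin t * (ps * cos phit) + cos t * (ps * sin phit))
        - r ^+ 2 * ((cos t ^+ 2 - sin t ^+ 2) * (et * cos phi)
                    - 2 * sin t * cos t * (et * sin phi))))); last first.
  by rewrite cos2Dsin2; ring.
have [s10 s20 r0] : [/\ s1 != 0, s2 != 0 & 1 - rho ^+ 2 != 0] by rewrite !gt_eqF.
rewrite psic psis etac etas /beta /K.
by field; rewrite ?s10 ?s20 ?r0.
Qed.

Lemma normal2_pdf_polar (r t : R) :
  normal2_pdf (cvec2 mu1 mu2) (cov2 s1 s2 rho) (r * cos t, r * sin t) =
  alpha mu1 mu2 s1 s2 rho / (2 * pi) * expR (- beta s1 s2 rho * r ^+ 2) *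
  (expR (psi mu1 mu2 s1 s2 rho * r * cos (t + (phit - pi / 2))) *
   expR (eta s1 s2 rho * r ^+ 2 *
         cos (2 * (t + (phit - pi / 2) - (phit - phi / 2))))).
Proof.
rewrite normal2_pdfE quadratic_form_polar !expRD /alpha.
move: (expR _) (expR _) (expR _) (expR _) => e1 e2 e3 e4.
by rewrite !invfM; ring.
Qed.

(** The antipode only changes the sign of the harmonic of frequency one. *)
Lemma normal2_pdf_antipodal (r t : R) :
  normal2_pdf (cvec2 mu1 mu2) (cov2 s1 s2 rho) (r * cos t, r * sin t) +
  normal2_pdf (cvec2 mu1 mu2) (cov2 s1 s2 rho) (- r * cos t, - r * sin t) =
  alpha mu1 mu2 s1 s2 rho * expR (- beta s1 s2 rho * r ^+ 2) / pi *
  (cosh_cos (psi mu1 mu2 s1 s2 rho * r) (t + (phit - pi / 2)) *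
   expR (eta s1 s2 rho * r ^+ 2 *
         cos (2 * (t + (phit - pi / 2) - (phit - phi / 2))))).
Proof.
rewrite !normal2_pdf_polar sqrrN /cosh_cos mulrN (mulNr (psi _ _ _ _ _ * r)).
move: pi (lt0r_neq0 (pi_gt0 R)) => p p0.
by field.
Qed.

End constants.
End bivariate_normal_norm.

(** * Measurability and nonnegativity *)

Section measurability.
Variable R : realType.

Lemma normal2_pdf_ge0 (m : 'cV[R]_2) (S : 'M[R]_2) z : 0 <= normal2_pdf m S z.
Proof. by rewrite mulr_ge0 ?expR_ge0// invr_ge0 sqrtr_ge0. Qed.

Lemma measurable_normal2_pdf (mu1 mu2 s1 s2 rho : R) :
  0 < s1 -> 0 < s2 -> `|rho| < 1 ->
  measurable_fun setT (normal2_pdf (cvec2 mu1 mu2) (cov2 s1 s2 rho)).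
Proof.
move=> s10 s20 rho1.
pose q (z : R * R) := - (s2 ^+ 2 * (z.1 - mu1) ^+ 2
     - 2 * rho * s1 * s2 * (z.1 - mu1) * (z.2 - mu2)
     + s1 ^+ 2 * (z.2 - mu2) ^+ 2) / (2 * (s1 ^+ 2 * s2 ^+ 2 * (1 - rho ^+ 2))).
have m1 : measurable_fun [set: R * R] (fun z : R * R => z.1 - mu1).
  by apply: measurable_funB => //; exact: measurable_fst.
have m2 : measurable_fun [set: R * R] (fun z : R * R => z.2 - mu2).
  by apply: measurable_funB => //; exact: measurable_snd.
have mq : measurable_fun setT q.
  apply: measurable_funM => //.
  apply: (measurableT_comp (@oppr_measurable R setT)).
  apply: measurable_funD.
    apply: measurable_funB.
      by apply: measurable_funM => //; exact: measurable_funX.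
    by apply: measurable_funM => //; apply: measurable_funM.
  by apply: measurable_funM => //; exact: measurable_funX.
rewrite (_ : normal2_pdf _ _ = fun z =>
    (2 * pi * (s1 * s2 * Num.sqrt (1 - rho ^+ 2)))^-1 * expR (q z)).
  by apply: measurable_funM => //; exact: measurableT_comp.
by apply/funext => -[x y]; rewrite normal2_pdfE.
Qed.

Lemma measurable_besselI (m : nat) : measurable_fun setT (besselI m : R -> R).
Proof.
apply: (measurable_fun_cvg (h := fun n x => series (besselI_coeff m x) n)) => [n|x _].
  elim: n => [|n IH].
    rewrite (_ : (fun x => _) = cst 0)//.
    by apply/funext => x; rewrite /series /= big_geq.
  rewrite (_ : (fun x => _) =
      (fun x => series (besselI_coeff m x) n) \+ (fun x => besselI_coeff m x n)).
    apply: measurable_funD => //; apply: measurable_funM => //.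
    by apply: measurable_funX; exact: measurable_funM.
  by apply/funext => x; rewrite /series /= big_nat_recr.
exact: is_cvg_series_besselI_coeff.
Qed.

Lemma measurable_norm_term (p e d : R) (j : nat) :
  measurable_fun setT (fun r => norm_term p e d r j).
Proof.
apply: measurable_funM => //; apply: measurable_funM.
  apply: measurable_funM => //; apply: measurableT_comp; first exact: measurable_besselI.
  exact: measurable_funM.
apply: measurableT_comp; first exact: measurable_besselI.
by apply: measurable_funM => //; exact: measurable_funX.
Qed.

Lemma measurable_lim_norm_term (p e d : R) (D : set R) :
  (forall r, D r -> cvgn (series (norm_term p e d r))) ->
  measurable_fun D (fun r => limn (series (norm_term p e d r))).
Proof.
move=> cD.
apply: (measurable_fun_cvg (h := fun n r => series (norm_term p e d r) n)) => [n|r Dr].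
  apply: measurable_funTS; elim: n => [|n IH].
    rewrite (_ : (fun x => _) = cst 0)//.
    by apply/funext => x; rewrite /series /= big_geq.
  rewrite (_ : (fun x => _) =
      (fun r => series (norm_term p e d r) n) \+ (fun r => norm_term p e d r n)).
    by apply: measurable_funD => //; exact: measurable_norm_term.
  by apply/funext => x; rewrite /series /= big_nat_recr.
exact: cD.
Qed.

End measurability.

(** * The density of the norm *)

Theorem mainTheorem1 (R : realType) (d : measure_display) (T : measurableType d)
    (P : probability T R) (X : {RV P >-> (R * R)%type})
    (mu1 mu2 s1 s2 rho phit phi : R)
    (s1_gt0 : 0 < s1) (s2_gt0 : 0 < s2) (rho_lt1 : `|rho| < 1)
    (X_normal : bivariate_normal X (cvec2 mu1 mu2) (cov2 s1 s2 rho))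
    (phitP : is_phit mu1 mu2 s1 s2 rho phit) (phiP : is_phi s1 s2 rho phi) :
  let a := alpha mu1 mu2 s1 s2 rho in
  let b := beta s1 s2 rho in
  let u := norm_term (psi mu1 mu2 s1 s2 rho) (eta s1 s2 rho)
             (phit - phi / 2) in
  (forall r : R, 0 < r -> cvgn (series (u r))) /\
  has_pdf (enorm2 X : {RV P >-> R})
    (fun r : R => a * r * expR (- b * r ^+ 2) * limn (series (u r))
                  * \1_`]0, +oo[ r).
Proof.
move=> a b u.
have rho2_gt0 : 0 < 1 - rho ^+ 2 by rewrite subr_gt0 -real_normK ?num_real// expr_lt1.
have psi_ge0 : 0 <= psi mu1 mu2 s1 s2 rho.
  by rewrite divr_ge0 ?sqrtr_ge0// !mulr_ge0 ?exprn_ge0// ltW.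
have eta_ge0 : 0 <= eta s1 s2 rho.
  by rewrite divr_ge0 ?sqrtr_ge0// !mulr_ge0 ?exprn_ge0// ltW.
have a_ge0 : 0 <= a.
  by rewrite mulr_ge0 ?expR_ge0// invr_ge0 !mulr_ge0 ?sqrtr_ge0// ltW.
pose G r t := cosh_cos (psi mu1 mu2 s1 s2 rho * r) (t + (phit - pi / 2)) *
   expR (eta s1 s2 rho * r ^+ 2 *
         cos (2 * (t + (phit - pi / 2) - (phit - phi / 2)))).
pose I r := (\int[lebesgue_measure]_(t in `[- (pi / 2), (pi / 2)]) G r t)%R.
have ul r : 0 < r -> series (u r) @ \oo --> pi^-1 * I r.
  move=> r0; apply: bessel_product_integral; first by rewrite mulr_ge0// ltW.
  by rewrite mulr_ge0// sqr_ge0.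
have cu r : 0 < r -> cvgn (series (u r)).
  by move=> /ul h; apply/cvg_ex; eexists; exact: h.
have limu r : 0 < r -> limn (series (u r)) = pi^-1 * I r.
  by move=> /ul h; apply/cvg_lim.
have cG r : continuous (G r).
  move=> t; apply: cvgM; first exact: continuous_cosh_cos.
  under eq_fun do rewrite -addrA.
  by rewrite -addrA; exact: continuous_expR_cos.
have G_ge0 r t : 0 <= G r t.
  by rewrite mulr_ge0 ?expR_ge0// divr_ge0// addr_ge0 ?expR_ge0.
pose g r := a * r * expR (- b * r ^+ 2) * limn (series (u r)).
have gE : (fun r : R => a * r * expR (- b * r ^+ 2) * limn (series (u r)) * \1_`]0, +oo[ r)
    = g \_ `]0, +oo[.
  apply/funext => r; rewrite patchE indicE /g; case: (r \in _).
    by rewrite mulr1.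
  by rewrite mulr0.
split => //; rewrite gE; split.
- apply/(measurable_restrictT _ (measurable_itv _)).
  apply: measurable_funM; last first.
    by apply: measurable_lim_norm_term => r /=; rewrite in_itv/= andbT; exact: cu.
  apply: measurable_funTS; apply: measurable_funM; first exact: measurable_funM.
  apply: measurableT_comp => //; apply: measurable_funM => //; exact: measurable_funX.
- move=> r; rewrite patchE; case: ifPn => //; rewrite inE /= in_itv/= andbT => r0.
  rewrite /g limu//; apply: mulr_ge0.
    by rewrite mulr_ge0 ?expR_ge0// mulr_ge0// ltW.
  apply: mulr_ge0; first by rewrite invr_ge0; exact: pi_ge0.
  by apply: Rintegral_ge0 => t _.
move=> A mA.
pose D := [set z : R * R | A (Num.sqrt (z.1 ^+ 2 + z.2 ^+ 2))].
have mD : measurable D by exact: measurable_norm_preimage.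
transitivity (distribution P X D); first by [].
rewrite X_normal// polar_norm//; last 3 first.
- exact: measurable_normal2_pdf.
- by move=> z; exact: normal2_pdf_ge0.
- move=> r.
  rewrite (_ : (fun t => _) = fun t => a / (2 * pi) * expR (- b * r ^+ 2) *
    (expR (psi mu1 mu2 s1 s2 rho * r * cos (1 * (t + (phit - pi / 2)))) *
     expR (eta s1 s2 rho * r ^+ 2 *
           cos (2 * (t + (phit - pi / 2 - (phit - phi / 2))))))).
    move=> t; apply: cvgM; first exact: cvg_cst.
    by apply: cvgM; exact: continuous_expR_cos.
  apply/funext => t.
  by rewrite (normal2_pdf_polar s1_gt0 s2_gt0 rho_lt1 phitP phiP) mul1r (addrA t (phit - pi / 2)).
rewrite integral_mkcondr; apply: eq_integral => r _.
rewrite !patchE; case: ifPn => //; rewrite inE /= in_itv/= andbT => r0.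
under eq_integral do rewrite (normal2_pdf_antipodal s1_gt0 s2_gt0 rho_lt1 phitP phiP).
rewrite -/a -/b; set c := a * _ / pi.
have iG : lebesgue_measure.-integrable `[- (pi / 2), pi / 2] (EFin \o G r).
  exact: continuous_integrable_itv.
under eq_integral do rewrite EFinM.
rewrite (integralZl _ iG)// -[X in (_ * (_ * X))%E]fineK; last exact: integrable_fin_num.
rewrite -[fine _]/(I r) -!EFinM /g limu// /c; congr EFin; ring.
Qed.
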